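(* Let $G$ be a finite group and $H,K$ subgroups of $G$. Put $\mathcal{C}^{(-1)}(H,K):=G$, fix $g_0\in \mathcal{C}^{(-1)}(H,K)$, and construct finite sequences $\{g_n\}_{n\geq 0}$ and $\{\mathcal{C}^{(n)}(H,K)\}_{n\geq -1}$ as follows (procedure MTA). If $g_0,\dots,g_n$ and $\mathcal{C}^{(-1)}(H,K),\dots,\mathcal{C}^{(n-1)}(H,K)$ have been defined for an integer $n\geq 0$, set $$\mathcal{C}^{(n)}(H,K):=\mathcal{C}^{(n-1)}(H,K)\cap (Hg_nK)^c,$$ and then, if $\mathcal{C}^{(n)}(H,K)$ is nonempty, choose an (arbitrary) element $g_{n+1}\in\mathcal{C}^{(n)}(H,K)$ and put $X_n:=\{g_0,\dots,g_{n+1}\}$; also $X_{-1}:=\{g_0\}$. (Thus $\mathcal{C}^{(n)}(H,K)=\bigcap_{i=0}^{n}(Hg_iK)^c$ for all $n\geq 0$.) Then, for any choices made in the procedure, there exists a least integer $N\geq 0$ such that $\mathcal{C}^{(N)}(H,K)=\emptyset$ (equivalently, $HX_{N-1}K=G$), the number of double cosets of $(H,K)$ in $G$ is $N+1$, and $X:=X_{N-1}$ (which has $N+1$ elements) is a complete set of double coset representatives of $(H,K)$ in $G$. Moreover, every complete set of double coset representatives of $(H,K)$ in $G$ can be obtained from this procedure, i.e. it equals the output $X_{N-1}$ for some admissible choice of $g_0,g_1,\dots,g_N$.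
   Context: For $S\subseteq G$, $S^c:=G\setminus S$. Double cosets of $(H,K)$ are the sets $HgK=\{hgk:h\in H,k\in K\}$, $g\in G$. A complete set of double coset representatives of $(H,K)$ in $G$ (also called a middle transversal of $(H,K)$) is a subset $X\subseteq G$ containing exactly one element of each double coset $HgK$. *)

(* Defs.v *)
From mathcomp Require Import all_boot all_fingroup.
Set Implicit Arguments.
Unset Strict Implicit.
Unset Printing Implicit Defensive.

Local Open Scope group_scope.

Section DoubleCosets.

Variables (gT : finGroupType) (G H K : {set gT}).
Implicit Types (X : {set gT}) (g : nat -> gT).

Definition dcoset (x : gT) : {set gT} := H :* x * K.

Definition dcosets : {set {set gT}} := [set dcoset x | x in G].

Definition dcoset_reps X : Prop :=
  X \subset G /\ forall D, D \in dcosets -> #|X :&: D| = 1%N.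

(* Indices are shifted by one so that they start at 0 rather than -1:         *)
(*   mtaC g n is C^(n-1)(H, K)  and  mtaX g n is X_(n-1) = {g_0, ..., g_n}.   *)
Fixpoint mtaC g (n : nat) : {set gT} :=
  if n is m.+1 then mtaC g m :&: (G :\: dcoset (g m)) else G.

Definition mtaX g (n : nat) : {set gT} := [set g i | i : 'I_n.+1].

(* The finite sequence of choices is represented by a total function g: once  *)
(* some C^(n) is empty, the later values of g are unconstrained and are not   *)
(* part of the construction.                                                  *)
Definition mta_choices g : Prop :=
  g 0%N \in G /\
  forall n, mtaC g n.+1 != set0 -> g n.+1 \in mtaC g n.+1.

Definition mta_stops_at g (N : nat) : Prop :=
  mtaC g N.+1 = set0 /\ forall n, mtaC g n.+1 = set0 -> (N <= n)%N.

End DoubleCosets.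

(* Main.v *)
(** Double cosets partition [G], so [g n] avoids the double cosets of all its
    predecessors exactly when its own double coset is a new one. Hence the
    procedure enumerates the double cosets without repetition, and it stops
    once all of them are hit. Conversely, listing a transversal in any order
    gives an admissible run. *)
Require Import Defs.
From mathcomp Require Import all_boot all_fingroup.
Set Implicit Arguments.
Unset Strict Implicit.
Unset Printing Implicit Defensive.
Local Open Scope group_scope.

(** * Double cosets as classes of an equivalence relation *)

Section DoubleCosetTheory.

Variables (gT : finGroupType) (G H K : {group gT}).
Implicit Types (x y : gT) (X : {set gT}).

Lemma dcosetP x y :
  reflect (exists h k, [/\ h \in H, k \in K & y = h * x * k])
          (y \in dcoset H K x).
Proof.
apply: (iffP mulsgP) => [[_ k /rcosetP[h hH ->] kK ->]|[h [k [hH kK ->]]]].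
  by exists h, k.
by exists (h * x) k; rewrite // mem_rcoset mulgK.
Qed.

Lemma dcoset_refl x : x \in dcoset H K x.
Proof. by apply/dcosetP; exists 1, 1; rewrite !group1 mul1g mulg1. Qed.

Lemma dcoset_sym x y : (y \in dcoset H K x) = (x \in dcoset H K y).
Proof.
suff imp u v : v \in dcoset H K u -> u \in dcoset H K v by apply/idP/idP; exact: imp.
case/dcosetP=> h [k [hH kK ->]]; apply/dcosetP.
by exists h^-1, k^-1; rewrite !groupV !mulgA mulVg mul1g mulgK.
Qed.

Lemma dcoset_trans x y z :
  y \in dcoset H K x -> z \in dcoset H K y -> z \in dcoset H K x.
Proof.
case/dcosetP=> h [k [hH kK ->]] /dcosetP[h' [k' [hH' kK' ->]]].
by apply/dcosetP; exists (h' * h), (k * k'); rewrite !groupM // !mulgA.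
Qed.

Lemma dcoset_eqP x y : reflect (dcoset H K x = dcoset H K y) (y \in dcoset H K x).
Proof.
apply: (iffP idP) => [yx | ->]; last exact: dcoset_refl.
apply/setP=> z; apply/idP/idP; last exact: dcoset_trans.
by apply: dcoset_trans; rewrite -dcoset_sym.
Qed.

Lemma mem_mulg_dcoset X y :
  reflect (exists2 x, x \in X & y \in dcoset H K x) (y \in H * X * K).
Proof.
apply: (iffP mulsgP) => [[_ k /mulsgP[h x hH xX ->] kK ->]|].
  by exists x => //; apply/dcosetP; exists h, k.
case=> x xX /dcosetP[h [k [hH kK ->]]].
by exists (h * x) k => //; apply: mem_mulg.
Qed.

Lemma mulg_dcoset_sub X :
  H \subset G -> K \subset G -> X \subset G -> H * X * K \subset G.
Proof. by move=> sHG sKG sXG; rewrite !mul_subG. Qed.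

End DoubleCosetTheory.

(** * The stages of the procedure and its termination *)

Section Procedure.

Variables (gT : finGroupType) (G H K : {group gT}).
Implicit Types (x : gT) (g : nat -> gT) (X : {set gT}).

Lemma mtaC_sub g n : mtaC G H K g n \subset G.
Proof. by elim: n => //= n IHn; apply: subset_trans (subsetIl _ _) IHn. Qed.

(** Flattens the recursion. The bound is strict because stage [n] has removed only the double cosets
    of the choices made before [g n]. *)
Lemma mtaCP g n x :
  reflect (x \in G /\ forall i, i < n -> x \notin dcoset H K (g i))
          (x \in mtaC G H K g n).
Proof.
elim: n => [|n IHn] /=; first by apply: (iffP idP) => [//|[]].
rewrite !inE; apply: (iffP and3P) => [[/IHn[xG notD] nDx _]|[xG notD]].
  by split=> // i; rewrite ltnS leq_eqVlt => /predU1P[->|/notD].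
by split=> //; [apply/IHn; split=> // i lt_in; exact/notD/ltnW | exact: notD].
Qed.

Lemma mtaC_bigcap g n :
  mtaC G H K g n.+1 = \bigcap_(i < n.+1) (G :\: dcoset H K (g i)).
Proof.
apply/setP=> x; apply/mtaCP/bigcapP => [[xG notD] i _ | notD].
  by rewrite inE xG notD.
(* Membership in [G] is read off the factor at index 0; an empty intersection would be the whole of
   [gT], hence the successor in the statement. *)
split=> [|i lt_in]; first by have:= notD ord0 isT; rewrite inE => /andP[].
by have:= notD (Ordinal lt_in) isT; rewrite inE => /andP[].
Qed.

Lemma mtaX_P g n x :
  reflect (exists2 i, i <= n & x = g i) (x \in mtaX g n).
Proof.
apply: (iffP imsetP) => [[i _ ->]|[i le_in ->]]; first by exists i; rewrite -1?ltnS.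
by exists (inord i) => //; rewrite inordK.
Qed.

Lemma mtaC_eq0P g n :
  reflect (forall x, x \in G -> exists2 i, i < n & x \in dcoset H K (g i))
          (mtaC G H K g n == set0).
Proof.
apply: (iffP eqP) => [C0 x xG | cover].
  have [/existsP[i Dx]|/existsPn notD] :=
    boolP [exists i : 'I_n, x \in dcoset H K (g i)]; first by exists i.
  suff: x \in mtaC G H K g n by rewrite C0 inE.
  by apply/mtaCP; split=> // i lt_in; exact: (notD (Ordinal lt_in)).
apply/setP=> x; rewrite inE; apply/negP=> /mtaCP[xG notD].
by have [i /notD/negP] := cover x xG.
Qed.

(** Both sides say that the double cosets of [g 0], ..., [g n] cover [G]. Requiring [mtaX g n]
    inside [G] keeps the product in [G]: values of [g] past the stopping index are arbitrary. *)
Lemma mtaC_eq0_mulg g n :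
    H \subset G -> K \subset G -> mtaX g n \subset G ->
  mtaC G H K g n.+1 = set0 <-> H * mtaX g n * K = G.
Proof.
move=> sHG sKG sXG; split=> [/eqP/mtaC_eq0P cover | defG].
  apply/eqP; rewrite eqEsubset mulg_dcoset_sub //; apply/subsetP=> x xG.
  have [i lt_in Dx] := cover x xG.
  by apply/mem_mulg_dcoset; exists (g i) => //; apply/mtaX_P; exists i.
apply/eqP/mtaC_eq0P=> x; rewrite -[in x \in _]defG.
by case/mem_mulg_dcoset=> _ /mtaX_P[i le_in ->] Dx; exists i.
Qed.

Lemma mta_choices_mem g n :
  mta_choices G H K g -> mtaC G H K g n != set0 -> g n \in mtaC G H K g n.
Proof. by case=> g0G gS; case: n => [|n] //; apply: gS. Qed.

(** Each step removes at least the chosen [g n], which lies in its own double coset, so the stages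
    shrink strictly while they are nonempty. *)
Lemma card_mtaC g n :
    mta_choices G H K g -> mtaC G H K g n != set0 ->
  #|mtaC G H K g n| + n <= #|G|.
Proof.
move=> gP; elim: n => [|n IHn] Cn0; first by rewrite addn0.
have Cn1 : mtaC G H K g n != set0.
  by apply: contraNneq Cn0 => Cn; rewrite /= Cn set0I.
apply: leq_trans (IHn Cn1); rewrite addnS -addSn leq_add2r.
apply: proper_card; apply/properP; split; first exact: subsetIl.
by exists (g n); rewrite ?mta_choices_mem //= !inE dcoset_refl andbF.
Qed.

Lemma mta_stops g : mta_choices G H K g -> exists N, mta_stops_at G H K g N.
Proof.
move=> gP; have exN : exists n, mtaC G H K g n.+1 == set0.
  (* By [card_mtaC], a nonempty stage [#|G|.+1] would force [#|G|.+1 <= #|G|]. *)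
  exists #|G|; apply: contraTT isT => Cn.
  by have := card_mtaC gP Cn; rewrite leqNgt addnS ltnS leq_addl.
case: (ex_minnP exN) => N /eqP CN minN.
by exists N; split=> // n /eqP; apply: minN.
Qed.

Lemma mta_stops_at_mem g N n :
    mta_choices G H K g -> mta_stops_at G H K g N -> n <= N ->
  g n \in mtaC G H K g n.
Proof.
move=> gP [_ minN] le_nN; apply: mta_choices_mem => //.
(* Minimality of [N] speaks only of stages of successor index; stage 0 is [G], which contains 1. *)
case: n le_nN => [|n] lt_nN; first by apply/set0Pn; exists 1; exact: group1.
by apply: contraTneq lt_nN => /minN; rewrite -leqNgt.
Qed.

(** * The output of a stopped run is a transversal *)

Section Run.

Variables (g : nat -> gT) (N : nat).
Hypotheses (gP : mta_choices G H K g) (gN : mta_stops_at G H K g N).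

(** The later of two choices lies in a stage from which the double coset of the earlier one is
    already gone. *)
Lemma mta_dcoset_inj i j :
  i <= N -> j <= N -> g j \in dcoset H K (g i) -> i = j.
Proof.
wlog lt_ij : i j / i < j.
  move=> IH leiN lejN Dij; have [/IH->//|/IH IHji|//] := ltngtP i j.
  by rewrite -IHji // dcoset_sym.
move=> _ lejN; have /mtaCP[_ notD] := mta_stops_at_mem gP gN lejN.
by rewrite (negPf (notD i lt_ij)).
Qed.

Lemma mta_inj : injective (fun i : 'I_N.+1 => g i).
Proof.
move=> i j eq_g; apply/val_inj/mta_dcoset_inj; rewrite -1?ltnS ?ltn_ord //.
by rewrite eq_g dcoset_refl.
Qed.

Lemma mtaX_sub n : n <= N -> mtaX g n \subset G.
Proof.
move=> le_nN; apply/subsetP=> _ /mtaX_P[i le_in ->].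
apply: (subsetP (mtaC_sub g i)).
exact: mta_stops_at_mem gP gN (leq_trans le_in le_nN).
Qed.

Lemma card_mtaX : #|mtaX g N| = N.+1.
Proof. by rewrite /mtaX card_imset ?card_ord //; exact: mta_inj. Qed.

Lemma dcosets_mta : dcosets G H K = [set dcoset H K (g i) | i : 'I_N.+1].
Proof.
apply/setP=> D; apply/imsetP/imsetP=> [[x xG ->]|[i _ ->]]; last first.
  exists (g i) => //; apply: (subsetP (mtaX_sub (leqnn N))).
  by apply/mtaX_P; exists i; rewrite -1?ltnS.
(* Emptiness of stage [N.+1] means that no double coset is missed. *)
have /eqP/mtaC_eq0P/(_ x xG)[i lt_iN /dcoset_eqP Dx] := gN.1.
by exists (Ordinal lt_iN).
Qed.

Lemma card_dcosets_mta : #|dcosets G H K| = N.+1.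
Proof.
rewrite dcosets_mta card_imset ?card_ord // => i j /dcoset_eqP Dij.
by apply/val_inj/mta_dcoset_inj; rewrite -1?ltnS ?ltn_ord.
Qed.

Lemma mtaX_reps : dcoset_reps G H K (mtaX g N).
Proof.
split=> [|D]; first exact: mtaX_sub.
rewrite dcosets_mta => /imsetP[i _ ->]; apply/eqP/cards1P; exists (g i).
apply/setP=> x; rewrite !inE; apply/andP/eqP => [[/mtaX_P[j lejN ->] Dij]|->].
  by rewrite (mta_dcoset_inj _ lejN Dij) // -ltnS.
by split; [apply/mtaX_P; exists i; rewrite -1?ltnS | exact: dcoset_refl].
Qed.

End Run.

(** * Every transversal is the output of a run *)

Section Transversal.

Variable X : {set gT}.
Hypothesis repsX : dcoset_reps G H K X.

Lemma dcoset_reps_inj x y :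
  x \in X -> y \in X -> y \in dcoset H K x -> x = y.
Proof.
move=> xX yX Dxy; have [sXG cardX] := repsX.
have /cards1P[z defz] : #|X :&: dcoset H K x| == 1%N.
  by rewrite cardX // imset_f // (subsetP sXG).
have : x \in X :&: dcoset H K x by rewrite inE xX dcoset_refl.
have : y \in X :&: dcoset H K x by rewrite inE yX.
by rewrite defz !inE => /eqP-> /eqP->.
Qed.

Lemma dcoset_reps_cover x : x \in G -> exists2 y, y \in X & x \in dcoset H K y.
Proof.
move=> xG; have /eqP/cards1P[y defy] := repsX.2 _ (imset_f (dcoset H K) xG).
have : y \in X :&: dcoset H K x by rewrite defy inE.
by rewrite inE dcoset_sym => /andP[]; exists y.
Qed.

(** Any listing of [X] would do. The default 1 is reached only from index [#|X|] on, where the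
    stages are empty and choices are unconstrained. *)
Let g := nth 1 (enum X).

Lemma dcoset_reps_run :
  [/\ mta_choices G H K g, mta_stops_at G H K g #|X|.-1 & mtaX g #|X|.-1 = X].
Proof.
have gX n : n < #|X| -> g n \in X by move=> ltnX; rewrite -mem_enum mem_nth -?cardE.
have gI x : x \in X -> exists2 i, i < #|X| & x = g i.
  move=> xX; exists (index x (enum X)); first by rewrite cardE index_mem mem_enum.
  by rewrite /g nth_index ?mem_enum.
(* The double coset of 1 has a representative, so [#|X|.-1] really is the last index of the
   listing. *)
have X_gt0 : 0 < #|X|.
  by have [x xX _] := dcoset_reps_cover (group1 G); apply/card_gt0P; exists x.
(* Distinct elements of [X] lie in distinct double cosets, so each listed element survives the
   removals before it. *)
have CgX n : n < #|X| -> g n \in mtaC G H K g n.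
  move=> ltnX; apply/mtaCP; split=> [|i lt_in]; first exact/(subsetP repsX.1)/gX.
  have ltiX := ltn_trans lt_in ltnX.
  apply/negP=> /(dcoset_reps_inj (gX i ltiX) (gX n ltnX))/eqP.
  by rewrite nth_uniq -?cardE ?enum_uniq // ltn_eqF.
have C0 n : #|X| <= n -> mtaC G H K g n = set0.
  move=> leXn; apply/eqP/mtaC_eq0P=> x /dcoset_reps_cover[_ /gI[i ltiX ->] Dx].
  by exists i; rewrite // (leq_trans ltiX).
split.
- split=> [|n]; first exact: (CgX 0).
  by case: (ltnP n.+1 #|X|) => [/CgX //|/C0->]; rewrite eqxx.
- split=> [|n Cn0]; first by rewrite C0 // prednK.
  (* Stopping earlier is impossible: stage [n.+1] would still contain [g n.+1]. *)
  rewrite -ltnS prednK // leqNgt; apply/negP=> /CgX.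
  by rewrite Cn0 inE.
- apply/setP=> x; apply/mtaX_P/idP => [[i lei ->]|/gI[i ltiX ->]].
    by apply: gX; rewrite -(prednK X_gt0).
  by exists i; rewrite // -ltnS prednK.
Qed.

End Transversal.

End Procedure.

Theorem theorem2p4 (gT : finGroupType) (G H K : {group gT})
    (sHG : H \subset G) (sKG : K \subset G) :
  (forall g : nat -> gT, mta_choices G H K g ->
     (forall n : nat,
        mtaC G H K g n.+1 = \bigcap_(i < n.+1) (G :\: dcoset H K (g i))) /\
     exists N : nat,
       [/\ mta_stops_at G H K g N,
           forall n : nat, (n <= N)%N ->
             (mtaC G H K g n.+1 = set0 <-> H * mtaX g n * K = G),
           #|dcosets G H K| = N.+1,
           #|mtaX g N| = N.+1
         & dcoset_reps G H K (mtaX g N)]) /\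
  (forall X : {set gT}, dcoset_reps G H K X ->
     exists (g : nat -> gT) (N : nat),
       [/\ mta_choices G H K g, mta_stops_at G H K g N & mtaX g N = X]).
Proof.
split=> [g gP | X repsX]; last first.
  by exists (nth 1 (enum X)), #|X|.-1; exact: dcoset_reps_run.
split; first exact: mtaC_bigcap.
have [N gN] := mta_stops gP; exists N; split=> //.
- by move=> n le_nN; apply: mtaC_eq0_mulg; rewrite // (mtaX_sub gP gN).
- exact: card_dcosets_mta gP gN.
- exact: card_mtaX gP gN.
- exact: mtaX_reps gP gN.
Qed.
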